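(* Let $\Gamma\subseteq \mathbf{For}$ be a set of formulas and let $\alpha\in\mathbf{For}$ be a formula. Then $\alpha$ is a relational $HT$-consequence of $\Gamma$ if and only if $\alpha$ is an algebraic consequence of $\Gamma$; that is, $$\Gamma\models_{Rel}\alpha \quad\text{if and only if}\quad \Gamma\models_{Alg}\alpha .$$
   Context: Language. $\mathbf{VarProp}$ is a countable set of propositional variables. $\mathbf{For}$ is the least set containing $\mathbf{VarProp}$ and closed under the binary connectives $\wedge,\vee,\Rightarrow$ and the unary connectives $\neg,S_1,S_2$ (the freely generated set of formulas). HT-algebras. An $HT$-algebra is an algebra $A=(A,0,1,\wedge,\vee,\Rightarrow,\neg,S_1,S_2)$ such that $(A,0,1,\wedge,\vee,\Rightarrow,\neg)$ is a Heyting algebra (with $\neg a=a\Rightarrow 0$), and for all $a,b\in A$ and all $i,j\in\{1,2\}$: $S_i(a\wedge b)=S_ia\wedge S_ib$; $S_i(a\vee b)=S_ia\vee S_ib$; $S_2(a\Rightarrow b)=(S_2a\Rightarrow S_2b)$; $S_1(a\Rightarrow b)=(S_1a\Rightarrow S_1b)\wedge(S_2a\Rightarrow S_2b)$; $S_iS_ja=S_ja$; $S_1a\vee a=a$; $S_1a\vee\neg S_1a=1$. Algebraic semantics. An algebraic model is a pair $(A,h)$ where $A$ is an $HT$-algebra and $h:\mathbf{For}\to A$ is a homomorphism, i.e. $h$ preserves $\wedge,\vee,\Rightarrow,\neg,S_1,S_2$. A formula $\alpha$ is true in $(A,h)$ iff $h(\alpha)=1$. $\Gamma\models_{Alg}\alpha$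 means: for every algebraic model $(A,h)$, if $h(\gamma)=1$ for all $\gamma\in\Gamma$, then $h(\alpha)=1$. Relational semantics. An $HT$-frame is a system $K=(W,R,s_1,s_2)$ where (K0) $W$ is a nonempty set, $R$ is a binary relation on $W$, and $s_1,s_2:W\to W$ are functions, and for all $w,w'\in W$ and $i,j\in\{1,2\}$: (K1) $R$ is reflexive and transitive; (K2) $s_j(s_i(w))=s_j(w)$; (K3) $R(s_1(w),w)$; (K4) $R(w,s_2(w))$; (K5) $R(w,w')$ implies $R(s_i(w),s_i(w'))$ and $R(s_i(w'),s_i(w))$; (K6) for every $w\in W$ there are $i\in\{1,2\}$ and $w'\in W$ with $w=s_i(w')$. An $HT$-model based on $K$ is $M=(K,m)$ where $m:\mathbf{VarProp}\to\mathcal P(W)$ satisfies: $R(w,w')$ and $w\in m(p)$ imply $w'\in m(p)$. Satisfaction $M,w\ sat\ \alpha$ is defined recursively: $M,w\ sat\ p$ iff $w\in m(p)$; $M,w\ sat\ \alpha\wedge\beta$ iff $M,w\ sat\ \alpha$ and $M,w\ sat\ \beta$; $M,w\ sat\ \alpha\vee\beta$ iff $M,w\ sat\ \alpha$ or $M,w\ sat\ \beta$; $M,w\ sat\ \alpha\Rightarrow\beta$ iff for all $w'$, if $R(w,w')$ and $M,w'\ sat\ \alpha$ then $M,w'\ sat\ \beta$; $M,w\ sat\ \neg\alpha$ iff for all $w'$ with $R(w,w')$, not $M,w'\ sat\ \alpha$; $M,w\ sat\ S_i\alpha$ iff $M,s_i(w)\ sat\ \alpha$. A formula $\alpha$ is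 true in $M$ iff $M,w\ sat\ \alpha$ for every $w\in W$. $\Gamma\models_{Rel}\alpha$ means: for every $HT$-model $M$ (based on any $HT$-frame), if all formulas of $\Gamma$ are true in $M$ then $\alpha$ is true in $M$. *)

(* Defs.v *)
From Stdlib Require Import Ensembles Relation_Definitions.

Set Implicit Arguments.

Arguments In {U} _ _.

Definition countable (T : Type) : Prop :=
  exists f : T -> nat, forall x y, f x = f y -> x = y.

(* The index set {1, 2} of the operators S_1, S_2 and of the maps s_1, s_2. *)
Inductive idx : Set := i1 | i2.

Inductive formula (VarProp : Type) : Type :=
| Var (p : VarProp)
| And (a b : formula VarProp)
| Or (a b : formula VarProp)
| Imp (a b : formula VarProp)
| Neg (a : formula VarProp)
| SOp (i : idx) (a : formula VarProp).

(* [x <= y] in the lattice order is written [meet x y = x]; implication is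
   the residual of meet. The one-element algebra (bot = top) is allowed. *)
Record HeytingAlgebra : Type := {
  carrier :> Type;
  bot : carrier;
  top : carrier;
  meet : carrier -> carrier -> carrier;
  join : carrier -> carrier -> carrier;
  imp : carrier -> carrier -> carrier;
  neg : carrier -> carrier;
  meetC : forall a b, meet a b = meet b a;
  meetA : forall a b c, meet a (meet b c) = meet (meet a b) c;
  joinC : forall a b, join a b = join b a;
  joinA : forall a b c, join a (join b c) = join (join a b) c;
  meet_joinK : forall a b, meet a (join a b) = a;
  join_meetK : forall a b, join a (meet a b) = a;
  meet_bot : forall a, meet bot a = bot;
  meet_top : forall a, meet a top = a;
  imp_residual : forall a b c,
    meet c (imp a b) = c <-> meet (meet c a) b = meet c a;
  neg_imp_bot : forall a, neg a = imp a bot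
}.

Arguments bot {_}.
Arguments top {_}.

Record HTAlgebra : Type := {
  heyting :> HeytingAlgebra;
  op : idx -> heyting -> heyting;
  op_meet : forall i a b, op i (meet _ a b) = meet _ (op i a) (op i b);
  op_join : forall i a b, op i (join _ a b) = join _ (op i a) (op i b);
  op2_imp : forall a b, op i2 (imp _ a b) = imp _ (op i2 a) (op i2 b);
  op1_imp : forall a b,
    op i1 (imp _ a b) =
    meet _ (imp _ (op i1 a) (op i1 b)) (imp _ (op i2 a) (op i2 b));
  op_op : forall i j a, op i (op j a) = op j a;
  op1_join : forall a, join _ (op i1 a) a = a;
  op1_em : forall a, join _ (op i1 a) (neg _ (op i1 a)) = top
}.

Record AlgModel (VarProp : Type) : Type := {
  alg :> HTAlgebra;
  hom : formula VarProp -> alg;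
  hom_And : forall a b, hom (And a b) = meet _ (hom a) (hom b);
  hom_Or : forall a b, hom (Or a b) = join _ (hom a) (hom b);
  hom_Imp : forall a b, hom (Imp a b) = imp _ (hom a) (hom b);
  hom_Neg : forall a, hom (Neg a) = neg _ (hom a);
  hom_SOp : forall i a, hom (SOp i a) = op _ i (hom a)
}.

Definition alg_true (VarProp : Type) (M : AlgModel VarProp)
    (a : formula VarProp) : Prop :=
  hom M a = top.

Definition alg_consequence (VarProp : Type) (Gamma : Ensemble (formula VarProp))
    (a : formula VarProp) : Prop :=
  forall M : AlgModel VarProp,
    (forall g, In Gamma g -> alg_true M g) -> alg_true M a.

Record HTFrame : Type := {
  world :> Type;
  acc : relation world;
  smap : idx -> world -> world;
  world_nonempty : inhabited world;
  acc_refl : reflexive world acc;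
  acc_trans : transitive world acc;
  smap_smap : forall i j w, smap j (smap i w) = smap j w;
  acc_smap1 : forall w, acc (smap i1 w) w;
  acc_smap2 : forall w, acc w (smap i2 w);
  acc_smap : forall i w w', acc w w' ->
    acc (smap i w) (smap i w') /\ acc (smap i w') (smap i w);
  smap_onto : forall w, exists i w', w = smap i w'
}.

Record HTModel (VarProp : Type) : Type := {
  frame :> HTFrame;
  val : VarProp -> Ensemble frame;
  val_mono : forall p w w', acc _ w w' -> In (val p) w -> In (val p) w'
}.

Fixpoint sat (VarProp : Type) (M : HTModel VarProp) (w : M)
    (a : formula VarProp) : Prop :=
  match a with
  | Var p => In (val M p) w
  | And a b => sat M w a /\ sat M w b
  | Or a b => sat M w a \/ sat M w b
  | Imp a b => forall w', acc M w w' -> sat M w' a -> sat M w' b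
  | Neg a => forall w', acc M w w' -> ~ sat M w' a
  | SOp i a => sat M (smap M i w) a
  end.

Definition rel_true (VarProp : Type) (M : HTModel VarProp)
    (a : formula VarProp) : Prop :=
  forall w : M, sat M w a.

Definition rel_consequence (VarProp : Type) (Gamma : Ensemble (formula VarProp))
    (a : formula VarProp) : Prop :=
  forall M : HTModel VarProp,
    (forall g, In Gamma g -> rel_true M g) -> rel_true M a.

(* Main.v *)
(* The two semantics are exchanged by a Stone-style duality. The up-sets of an
   HT-frame form an HT-algebra in which a formula denotes its truth set; this
   gives one implication. Conversely, the prime filters of an HT-algebra A,
   ordered by inclusion, form an HT-frame with s_i(P) = {x | S_i x in P}, and a
   prime filter P satisfies a formula iff it contains its value (truth lemma);
   a value other than 1 is avoided by some prime filter. The crux is (K6):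
   always P = s_1(P) or P = s_2(P), because s_1(P) <= P <= s_2(P) and
   x /\ S_2 y <= S_1 x \/ y in every HT-algebra. *)
Require Import Defs.
From Stdlib Require Import Ensembles Classical FunctionalExtensionality
  PropExtensionality ProofIrrelevance.
From mathcomp Require classical_sets.

Set Implicit Arguments.

(** * Extensionality of predicates, and the order of a Heyting algebra *)

Lemma pred_ext (T : Type) (P Q : T -> Prop) : (forall x, P x <-> Q x) -> P = Q.
Proof.
  intro H; extensionality x; apply propositional_extensionality, H.
Qed.

Definition le (A : HeytingAlgebra) (x y : A) : Prop := meet A x y = x.

Lemma join_idem (A : HeytingAlgebra) (x : A) : join A x x = x.
Proof. rewrite <- (meet_top A x) at 2. apply join_meetK. Qed.

Lemma le_refl (A : HeytingAlgebra) (x : A) : le A x x.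
Proof. unfold le. rewrite <- (join_idem A x) at 2. apply meet_joinK. Qed.

Lemma le_trans (A : HeytingAlgebra) (x y z : A) :
  le A x y -> le A y z -> le A x z.
Proof.
  unfold le; intros xy yz. rewrite <- xy, <- meetA, yz. reflexivity.
Qed.

Lemma le_antisym (A : HeytingAlgebra) (x y : A) : le A x y -> le A y x -> x = y.
Proof. unfold le; intros xy yx. rewrite <- xy, meetC. exact yx. Qed.

Lemma le_top (A : HeytingAlgebra) (x : A) : le A x top.
Proof. apply meet_top. Qed.

Lemma bot_le (A : HeytingAlgebra) (x : A) : le A bot x.
Proof. apply meet_bot. Qed.

Lemma top_le (A : HeytingAlgebra) (x : A) : le A top x -> x = top.
Proof. intro H; apply le_antisym; [apply le_top | exact H]. Qed.

Lemma le_bot (A : HeytingAlgebra) (x : A) : le A x bot -> x = bot.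
Proof. intro H; apply le_antisym; [exact H | apply bot_le]. Qed.

Lemma meet_le_l (A : HeytingAlgebra) (x y : A) : le A (meet A x y) x.
Proof.
  unfold le. rewrite meetC, meetA. f_equal. apply le_refl.
Qed.

Lemma meet_le_r (A : HeytingAlgebra) (x y : A) : le A (meet A x y) y.
Proof. rewrite meetC. apply meet_le_l. Qed.

Lemma meet_glb (A : HeytingAlgebra) (x y z : A) :
  le A z x -> le A z y -> le A z (meet A x y).
Proof. unfold le; intros zx zy. rewrite meetA, zx. exact zy. Qed.

Lemma le_join_l (A : HeytingAlgebra) (x y : A) : le A x (join A x y).
Proof. apply meet_joinK. Qed.

Lemma le_join_r (A : HeytingAlgebra) (x y : A) : le A y (join A x y).
Proof. rewrite joinC. apply le_join_l. Qed.

Lemma le_joinE (A : HeytingAlgebra) (x y : A) : le A x y <-> join A x y = y.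
Proof.
  split; intro H.
  - rewrite <- H, (meetC _ x), joinC. apply join_meetK.
  - rewrite <- H. apply le_join_l.
Qed.

Lemma join_lub (A : HeytingAlgebra) (x y z : A) :
  le A x z -> le A y z -> le A (join A x y) z.
Proof.
  rewrite !le_joinE; intros xz yz. rewrite <- joinA, yz. exact xz.
Qed.

Lemma le_imp (A : HeytingAlgebra) (x y z : A) :
  le A z (imp A x y) <-> le A (meet A z x) y.
Proof. apply imp_residual. Qed.

Lemma imp_top (A : HeytingAlgebra) (x y : A) : le A x y <-> imp A x y = top.
Proof.
  split; intro H.
  - apply top_le, le_imp. apply le_trans with x; [apply meet_le_r | exact H].
  - apply le_trans with (meet A top x).
    + apply meet_glb; [apply le_top | apply le_refl].
    + apply le_imp. rewrite H. apply le_refl.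
Qed.

Lemma modus_ponens (A : HeytingAlgebra) (x y : A) :
  le A (meet A (imp A x y) x) y.
Proof. apply le_imp, le_refl. Qed.

Lemma imp_mono_r (A : HeytingAlgebra) (x y z : A) :
  le A y z -> le A (imp A x y) (imp A x z).
Proof.
  intro H; apply le_imp. apply le_trans with y; [apply modus_ponens | exact H].
Qed.

Lemma le_imp_const (A : HeytingAlgebra) (x y : A) : le A y (imp A x y).
Proof. apply le_imp, meet_le_l. Qed.

Lemma meet_neg (A : HeytingAlgebra) (x : A) : le A (meet A (neg A x) x) bot.
Proof. rewrite neg_imp_bot. apply modus_ponens. Qed.

(** * Order properties of the operators [S_1] and [S_2] *)

Lemma op_mono (A : HTAlgebra) (i : idx) (x y : A) :
  le A x y -> le A (op A i x) (op A i y).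
Proof. unfold le; intro H. rewrite <- op_meet, H. reflexivity. Qed.

Lemma op1_le (A : HTAlgebra) (x : A) : le A (op A i1 x) x.
Proof. apply le_joinE, op1_join. Qed.

(* Since [S_1 z <= z], it is enough that [S_1 (x => y) = 1], and [S_1 (x => y)]
   is the meet of the two implications [S_i x => S_i y]. *)
Lemma le_of_op (A : HTAlgebra) (x y : A) :
  (forall i, le A (op A i x) (op A i y)) -> le A x y.
Proof.
  intro H. apply imp_top, top_le.
  apply le_trans with (op A i1 (imp A x y)); [| apply op1_le].
  rewrite op1_imp. apply meet_glb.
  - rewrite (proj1 (imp_top _ _ _) (H i1)). apply le_refl.
  - rewrite (proj1 (imp_top _ _ _) (H i2)). apply le_refl.
Qed.

Lemma op1_le_op2 (A : HTAlgebra) (x : A) : le A (op A i1 x) (op A i2 x).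
Proof.
  rewrite <- (op_op A i2 i1). apply op_mono, op1_le.
Qed.

Lemma le_op2 (A : HTAlgebra) (x : A) : le A x (op A i2 x).
Proof.
  apply le_of_op; intros []; rewrite op_op; [apply op1_le_op2 | apply le_refl].
Qed.

Lemma op_top (A : HTAlgebra) (i : idx) : op A i top = top.
Proof.
  (* Written as [top => top], the element [top] is sent by [S_1] to a meet of implications of the
     form [u => u]. *)
  assert (E : top = imp A top top) by (symmetry; apply imp_top, le_refl).
  apply top_le; destruct i.
  - rewrite E at 2. rewrite op1_imp.
    rewrite !(proj1 (imp_top _ _ _) (le_refl _ _)). apply meet_glb; apply le_refl.
  - apply le_op2.
Qed.

Lemma op_bot (A : HTAlgebra) (i : idx) : op A i bot = bot.
Proof.
  assert (E : op A i1 bot = bot) by (apply le_bot, op1_le).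
  (* Replacing the inner [bot] by [S_1 bot] lets [op_op] absorb the outer operator, whichever it
     is. *)
  rewrite <- E at 1. rewrite op_op. exact E.
Qed.

(** Compare the images of both sides: under [S_1] both contain [S_1 x], as a factor on the left and
    as a summand on the right; under [S_2] both contain [S_2 y] in the same way. *)
Lemma meet_op2_le (A : HTAlgebra) (x y : A) :
  le A (meet A x (op A i2 y)) (join A (op A i1 x) y).
Proof.
  apply le_of_op; intros []; rewrite op_meet, op_join, !op_op.
  - apply le_trans with (op A i1 x); [apply meet_le_l | apply le_join_l].
  - apply le_trans with (op A i2 y); [apply meet_le_r | apply le_join_r].
Qed.

(** * Filters, and separation by prime filters *)

Record is_filter (A : HeytingAlgebra) (F : A -> Prop) : Prop := {
  filter_top : F top;
  filter_meet : forall x y, F x -> F y -> F (meet A x y);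
  filter_le : forall x y, le A x y -> F x -> F y
}.

Record is_prime (A : HeytingAlgebra) (F : A -> Prop) : Prop := {
  prime_filter : is_filter A F;
  prime_bot : ~ F bot;
  prime_join : forall x y, F (join A x y) -> F x \/ F y
}.

Lemma filter_top1 (A : HeytingAlgebra) : is_filter A (fun x => x = top).
Proof.
  split.
  - reflexivity.
  - intros x y -> ->. apply meet_top.
  - intros x y H ->. apply top_le, H.
Qed.

(** This is the filter generated by [F] and [b]: by residuation, [b => x] lies in [F] exactly when
    [f /\ b <= x] for some [f] in [F]. *)
Lemma filter_imp (A : HeytingAlgebra) (F : A -> Prop) (b : A) :
  is_filter A F -> is_filter A (fun x => F (imp A b x)).
Proof.
  intro HF; split.
  - apply (filter_le HF) with top; [apply le_imp_const | apply (filter_top HF)].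
  - intros x y Hx Hy.
    apply (filter_le HF) with (2 := filter_meet HF _ _ Hx Hy).
    apply le_imp, meet_glb.
    + apply le_trans with (2 := modus_ponens A b x).
      apply meet_glb; [| apply meet_le_r].
      apply le_trans with (1 := meet_le_l _ _ _). apply meet_le_l.
    + apply le_trans with (2 := modus_ponens A b y).
      apply meet_glb; [| apply meet_le_r].
      apply le_trans with (1 := meet_le_l _ _ _). apply meet_le_r.
  - intros x y xy. apply (filter_le HF), imp_mono_r, xy.
Qed.

Lemma maximal_filter_exists (A : HeytingAlgebra) (F : A -> Prop) (a : A) :
  is_filter A F -> ~ F a ->
  exists G, (is_filter A G /\ (forall x, F x -> G x) /\ ~ G a) /\
    forall H, is_filter A H -> (forall x, G x -> H x) -> ~ H a ->
      forall x, H x -> G x.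
Proof.
  intros HF Fa.
  (* Adding [F] to each member of a chain lets the empty chain be treated like
     the others. *)
  pose (ext X := fun x : A => F x \/ X x).
  destruct (@classical_sets.Zorn_bigcup A
    (fun X => is_filter A (ext X) /\ ~ ext X a)) as [X [[HX Xa] Xmax]].
  - intros C CP Ctot; split; [split |].
    + left; apply (filter_top HF).
    + intros x y [Fx | [X CX Xx]] [Fy | [Y CY Yy]].
      * left; apply (filter_meet HF); assumption.
      * destruct (filter_meet (proj1 (CP Y CY)) x y (or_introl Fx) (or_intror Yy))
          as [H | H]; [left; exact H | right; exists Y; assumption].
      * destruct (filter_meet (proj1 (CP X CX)) x y (or_intror Xx) (or_introl Fy))
          as [H | H]; [left; exact H | right; exists X; assumption].
      (* Both elements already lie in the larger of the two members of the chain, which is closed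
         under meets. *)
      * destruct (Ctot X Y CX CY) as [XY | YX].
        -- destruct (filter_meet (proj1 (CP Y CY)) x y
             (or_intror (XY x Xx)) (or_intror Yy))
             as [H | H]; [left; exact H | right; exists Y; assumption].
        -- destruct (filter_meet (proj1 (CP X CX)) x y
             (or_intror Xx) (or_intror (YX y Yy)))
             as [H | H]; [left; exact H | right; exists X; assumption].
    + intros x y xy [Fx | [X CX Xx]].
      * left; apply (filter_le HF) with x; assumption.
      * destruct (filter_le (proj1 (CP X CX)) xy (or_intror Xx))
          as [H | H]; [left; exact H | right; exists X; assumption].
    + intros [H | [X CX Xx]]; [exact (Fa H) |].
      apply (proj2 (CP X CX)). right; exact Xx.
  - exists (ext X); split; [split; [| split] |].
    + exact HX.
    + intros x Fx; left; exact Fx.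
    + exact Xa.
    + intros H HH XH Ha x Hx. apply NNPP; intro nx.
      (* Since [H] contains [F], it is itself a candidate in the family ordered by Zorn's lemma, so
         it cannot properly extend [X]. *)
      assert (E : ext H = H).
      { apply pred_ext; intro y; split; [intros [Fy | Hy] | intro Hy].
        - apply XH; left; exact Fy.
        - exact Hy.
        - right; exact Hy. }
      apply (Xmax H).
      * split; [intros y Xy; apply XH; right; exact Xy |].
        intro HX'. apply nx. right. apply HX', Hx.
      * rewrite E. split; assumption.
Qed.

(** A filter [G] maximal among those that extend [F] and avoid [a] is prime. If [b] is not in [G],
    the filter generated by [G] and [b] must contain [a], so [b => a] is in [G]. If neither [b] nor
    [c] were in [G] but their join were, then [a] would follow. *)
Lemma prime_filter_exists (A : HeytingAlgebra) (F : A -> Prop) (a : A) :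
  is_filter A F -> ~ F a ->
  exists P, is_prime A P /\ (forall x, F x -> P x) /\ ~ P a.
Proof.
  intros HF Fa.
  destruct (maximal_filter_exists a HF Fa) as [G [[HG [FG Ga]] Gmax]].
  exists G; split; [| split; assumption].
  assert (step : forall b, ~ G b -> G (imp A b a)).
  { intros b Gb. apply NNPP; intro n. apply Gb.
    apply (Gmax (fun x => G (imp A b x))).
    - apply filter_imp, HG.
    - intro x. apply (filter_le HG), le_imp_const.
    - exact n.
    - rewrite (proj1 (imp_top _ _ _) (le_refl _ _)). apply (filter_top HG). }
  split.
  - exact HG.
  - intro H. apply Ga. apply (filter_le HG) with bot; [apply bot_le | exact H].
  - intros b c Hbc. apply NNPP; intro n. apply Ga.
    apply not_or_and in n; destruct n as [nb nc].
    apply (filter_le HG) with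
      (2 := filter_meet HG _ _ Hbc (filter_meet HG _ _ (step b nb) (step c nc))).
    (* Residuation moves the two implications to the right, which leaves the join alone on the left
       to be split. *)
    apply le_imp, join_lub; apply le_imp; rewrite meetC.
    + apply le_trans with (2 := modus_ponens A b a).
      apply meet_glb; [| apply meet_le_r].
      apply le_trans with (1 := meet_le_l _ _ _). apply meet_le_l.
    + apply le_trans with (2 := modus_ponens A c a).
      apply meet_glb; [| apply meet_le_r].
      apply le_trans with (1 := meet_le_l _ _ _). apply meet_le_r.
Qed.

(** * The frame of prime filters *)

Lemma prime_op (A : HTAlgebra) (i : idx) (P : A -> Prop) :
  is_prime A P -> is_prime A (fun x => P (op A i x)).
Proof.
  (* [S_i] is an endomorphism of the bounded lattice, and the preimage of a prime filter under such
     a map is prime. *)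
  intro HP; pose proof (prime_filter HP) as HF; split; [split | |].
  - rewrite op_top. apply (filter_top HF).
  - intros x y. rewrite op_meet. apply (filter_meet HF).
  - intros x y xy. apply (filter_le HF), op_mono, xy.
  - rewrite op_bot. apply (prime_bot HP).
  - intros x y. rewrite op_join. apply (prime_join HP).
Qed.

Definition spec (A : HeytingAlgebra) : Type := {P : A -> Prop | is_prime A P}.

Definition spec_acc (A : HeytingAlgebra) (P Q : spec A) : Prop :=
  forall x, proj1_sig P x -> proj1_sig Q x.

Definition spec_smap (A : HTAlgebra) (i : idx) (P : spec A) : spec A :=
  exist _ (fun x => proj1_sig P (op A i x)) (prime_op A i (proj2_sig P)).

Lemma spec_ext (A : HeytingAlgebra) (P Q : spec A) :
  (forall x, proj1_sig P x <-> proj1_sig Q x) -> P = Q.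
Proof.
  intro H.
  destruct P as [P HP], Q as [Q HQ]; simpl in H.
  apply subset_eq_compat, pred_ext, H.
Qed.

Lemma spec_smap_smap (A : HTAlgebra) (i j : idx) (P : spec A) :
  spec_smap A j (spec_smap A i P) = spec_smap A j P.
Proof. apply spec_ext; intro x; simpl. rewrite op_op. reflexivity. Qed.

Lemma spec_acc_smap1 (A : HTAlgebra) (P : spec A) : spec_acc (spec_smap A i1 P) P.
Proof.
  intro x; apply (filter_le (prime_filter (proj2_sig P))), op1_le.
Qed.

Lemma spec_acc_smap2 (A : HTAlgebra) (P : spec A) : spec_acc P (spec_smap A i2 P).
Proof.
  intro x; apply (filter_le (prime_filter (proj2_sig P))), le_op2.
Qed.

Lemma op_em (A : HTAlgebra) (i : idx) (x : A) :
  join A (op A i x) (neg A (op A i x)) = top.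
Proof. rewrite <- (op_op A i1 i). apply op1_em. Qed.

(** Nested prime filters agree on complemented elements, and each [S_i x] is complemented by
    [op_em]: if [P] lacks it, then [P], and hence [Q], contains its negation. *)
Lemma spec_acc_smap (A : HTAlgebra) (i : idx) (P Q : spec A) :
  spec_acc P Q ->
  spec_acc (spec_smap A i P) (spec_smap A i Q) /\
  spec_acc (spec_smap A i Q) (spec_smap A i P).
Proof.
  intro PQ; split; intros x; simpl; [apply PQ |]; intro Qx.
  pose proof (filter_top (prime_filter (proj2_sig P))) as H.
  rewrite <- (op_em A i x) in H.
  apply (prime_join (proj2_sig P)) in H. destruct H as [H | H]; [exact H |].
  exfalso; apply (prime_bot (proj2_sig Q)).
  pose proof (prime_filter (proj2_sig Q)) as HQ.
  apply (filter_le HQ) with (1 := meet_neg A (op A i x)).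
  apply (filter_meet HQ); [apply PQ, H | exact Qx].
Qed.

Lemma spec_smap_onto (A : HTAlgebra) (P : spec A) :
  exists i Q, P = spec_smap A i Q.
Proof.
  pose proof (prime_filter (proj2_sig P)) as HF.
  (* The preimage is [P] itself. An [x] in [P] with [S_1 x] outside [P] forces [P = s_2(P)]: if
     [S_2 y] is in [P], then [meet_op2_le] and primeness put [y] in [P]. Without such an [x],
     [P = s_1(P)]. *)
  destruct (classic (exists x, proj1_sig P x /\ ~ proj1_sig P (op A i1 x)))
    as [[x [Px nx]] | n].
  - exists i2, P. apply spec_ext; intro y; split; [apply spec_acc_smap2 |].
    simpl; intro Py.
    pose proof (filter_le HF (meet_op2_le A x y) (filter_meet HF _ _ Px Py))
      as H.
    apply (prime_join (proj2_sig P)) in H.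
    destruct H as [H | H]; [contradiction | exact H].
  - exists i1, P. apply spec_ext; intro y; split; [| apply spec_acc_smap1].
    simpl; intro Py. apply NNPP; intro ny. apply n; exists y; split; assumption.
Qed.

(** Nonemptiness is an argument because the one-element algebra has no prime filter. *)
Definition spec_frame (A : HTAlgebra) (ne : inhabited (spec A)) : HTFrame := {|
  world := spec A;
  acc := @spec_acc A;
  smap := @spec_smap A;
  world_nonempty := ne;
  acc_refl := fun P x Px => Px;
  acc_trans := fun P Q R PQ QR x Px => QR x (PQ x Px);
  smap_smap := @spec_smap_smap A;
  acc_smap1 := @spec_acc_smap1 A;
  acc_smap2 := @spec_acc_smap2 A;
  acc_smap := @spec_acc_smap A;
  smap_onto := @spec_smap_onto A
|}.

(** * The model on prime filters and its truth lemma *)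

Definition spec_model (V : Type) (M : AlgModel V) (ne : inhabited (spec M)) :
    HTModel V := {|
  frame := spec_frame M ne;
  val := fun p (P : spec_frame M ne) => proj1_sig P (hom M (Var p));
  val_mono := fun p P Q PQ => PQ _
|}.

(** From right to left: if [x => y] is not in [P], the filter generated by [P] and [x] avoids [y],
    and a prime filter extending it while still avoiding [y] is a counterexample. *)
Lemma spec_imp (A : HeytingAlgebra) (P : spec A) (x y : A) :
  proj1_sig P (imp A x y) <->
  forall Q, spec_acc P Q -> proj1_sig Q x -> proj1_sig Q y.
Proof.
  pose proof (prime_filter (proj2_sig P)) as HP; split.
  - intros Pxy Q PQ Qx. pose proof (prime_filter (proj2_sig Q)) as HQ.
    apply (filter_le HQ) with (1 := modus_ponens A x y).
    apply (filter_meet HQ); [apply PQ, Pxy | exact Qx].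
  - intro H. apply NNPP; intro n.
    destruct (prime_filter_exists y (filter_imp x HP) n)
      as [Q [HQ [PQ Qy]]].
    apply Qy, (H (exist _ Q HQ)); simpl.
    + intros z Pz. apply PQ, (filter_le HP) with (2 := Pz), le_imp_const.
    + apply PQ. rewrite (proj1 (imp_top _ _ _) (le_refl _ _)).
      apply (filter_top HP).
Qed.

Lemma sat_spec (V : Type) (M : AlgModel V) (ne : inhabited (spec M))
    (a : formula V) (P : spec M) :
  sat (spec_model M ne) P a <-> proj1_sig P (hom M a).
Proof.
  revert P; induction a as [p | a IHa b IHb | a IHa b IHb | a IHa b IHb | a IHa
    | i a IHa]; intro P; simpl;
    pose proof (prime_filter (proj2_sig P)) as HP.
  - reflexivity.
  - rewrite hom_And, IHa, IHb. split.
    + intros [Pa Pb]; apply (filter_meet HP); assumption.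
    + intro H; split; apply (filter_le HP) with (2 := H);
        [apply meet_le_l | apply meet_le_r].
  - rewrite hom_Or, IHa, IHb. split.
    + intros [H | H]; apply (filter_le HP) with (2 := H);
        [apply le_join_l | apply le_join_r].
    + apply (prime_join (proj2_sig P)).
  - rewrite hom_Imp, spec_imp. split; intros H Q PQ Qa.
    + apply IHb, H, IHa; assumption.
    + apply IHb, H, IHa; assumption.
  - rewrite hom_Neg, neg_imp_bot, spec_imp. split; intros H Q PQ Qa.
    + exfalso; apply (H Q PQ), IHa, Qa.
    + apply (prime_bot (proj2_sig Q)), H, IHa; assumption.
  - rewrite hom_SOp. apply (IHa (spec_smap M i P)).
Qed.

Lemma rel_alg (V : Type) (Gamma : Ensemble (formula V)) (alpha : formula V) :
  rel_consequence Gamma alpha -> alg_consequence Gamma alpha.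
Proof.
  intros H M MG. apply NNPP; intro n.
  destruct (prime_filter_exists (hom M alpha) (filter_top1 M) n) as [P [HP [_ Pa]]].
  (* The prime filter that refutes [alpha] also shows that the frame is nonempty. *)
  pose (ne := inhabits (exist _ P HP : spec M)).
  apply Pa, (sat_spec M ne alpha (exist _ P HP)), H.
  intros g Gg Q. apply sat_spec. rewrite (MG g Gg).
  apply (filter_top (prime_filter (proj2_sig Q))).
Qed.

(** * The HT-algebra of up-sets of a frame *)

Definition is_upset (K : HTFrame) (X : K -> Prop) : Prop :=
  forall w v, acc K w v -> X w -> X v.

Definition upset (K : HTFrame) : Type := {X : K -> Prop | is_upset K X}.

Lemma upset_ext (K : HTFrame) (X Y : upset K) :
  (forall w, proj1_sig X w <-> proj1_sig Y w) -> X = Y.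
Proof.
  intro H; destruct X as [X HX], Y as [Y HY]; simpl in H.
  apply subset_eq_compat, pred_ext, H.
Qed.

Lemma upset_extE (K : HTFrame) (X Y : upset K) :
  X = Y <-> forall w, proj1_sig X w <-> proj1_sig Y w.
Proof.
  split; [intros -> w; reflexivity | apply upset_ext].
Qed.

Program Definition up_bot (K : HTFrame) : upset K := fun _ => False.
Next Obligation. intros w v _ []. Qed.

Program Definition up_top (K : HTFrame) : upset K := fun _ => True.
Next Obligation. intros w v _ _; exact I. Qed.

Program Definition up_meet (K : HTFrame) (X Y : upset K) : upset K :=
  fun w => proj1_sig X w /\ proj1_sig Y w.
Next Obligation.
  intros w v wv [Xw Yw]; split;
    [apply (proj2_sig X) with w | apply (proj2_sig Y) with w]; assumption.
Qed.

Program Definition up_join (K : HTFrame) (X Y : upset K) : upset K :=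
  fun w => proj1_sig X w \/ proj1_sig Y w.
Next Obligation.
  intros w v wv [Xw | Yw];
    [left; apply (proj2_sig X) with w | right; apply (proj2_sig Y) with w];
    assumption.
Qed.

Program Definition up_imp (K : HTFrame) (X Y : upset K) : upset K :=
  fun w => forall v, acc K w v -> proj1_sig X v -> proj1_sig Y v.
Next Obligation.
  intros w v wv H u vu. apply H, (acc_trans K) with v; assumption.
Qed.

Program Definition up_op (K : HTFrame) (i : idx) (X : upset K) : upset K :=
  fun w => proj1_sig X (smap K i w).
Next Obligation.
  intros w v wv. apply (proj2_sig X), (acc_smap K i _ _ wv).
Qed.

Program Definition up_heyting (K : HTFrame) : HeytingAlgebra := {|
  carrier := upset K;
  bot := up_bot K;
  top := up_top K;
  meet := @up_meet K;
  join := @up_join K;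
  imp := @up_imp K;
  neg := fun X => up_imp X (up_bot K)
|}.
Solve Obligations with
  try now (intros; apply upset_ext; intro; simpl; tauto).
Next Obligation.
  (* Residuation: one direction instantiates the implication at [w] itself by reflexivity, the other
     uses that [c] is closed upwards. *)
  rewrite !upset_extE; simpl; split; intros H w.
  - specialize (H w). pose proof (fun h => proj2 H h) as H'.
    split; [tauto | intros [cw aw]; split; [tauto |]].
    apply H'; [exact cw | apply (acc_refl K) | exact aw].
  - split; [tauto | intro cw; split; [exact cw | intros v wv av]].
    apply (H v). split; [apply (proj2_sig c) with w |]; assumption.
Qed.

(** (K6) puts [w] in the image of some [s_i], and (K2) makes [s_i] idempotent. *)
Lemma smap_fixed (K : HTFrame) (w : K) : exists i, smap K i w = w.
Proof.
  destruct (smap_onto K w) as [i [v ->]]. exists i. apply smap_smap.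
Qed.

Program Definition up_algebra (K : HTFrame) : HTAlgebra := {|
  heyting := up_heyting K;
  op := @up_op K
|}.
Solve Obligations with
  try now (intros; apply upset_ext; intro; simpl; tauto).
Next Obligation.
  apply upset_ext; intro w; simpl; split.
  - intros H v wv. apply H, (acc_smap K i2 _ _ wv).
  (* A world [v] above [s_2(w)] is also below it, by (K4) and (K5). The two lie in the same up-sets,
     so the hypothesis at [w] suffices. *)
  - intros H v wv Xv. destruct (acc_smap K i2 _ _ wv) as [_ vw].
    rewrite smap_smap in vw.
    pose proof (acc_trans K _ _ _ (acc_smap2 K v) vw) as vw'.
    apply (proj2_sig b _ _ wv), H; [apply (acc_refl K) |].
    apply (proj2_sig a _ _ vw'), Xv.
Qed.
Next Obligation.
  apply upset_ext; intro w; simpl; split.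
  - intros H; split; intros v wv; apply H.
    + apply (acc_smap K i1 _ _ wv).
    + apply (acc_trans K) with w; [apply acc_smap1 |].
      apply (acc_trans K) with v; [exact wv | apply acc_smap2].
  (* Here (K6) is essential: [v] is fixed by some [s_i], and applying [s_i] to [R(s_1(w), v)] makes
     [v] equivalent to [s_i(w)]. The conjunct with that index then applies at [w]. *)
  - intros [H1 H2] v wv Xv. destruct (smap_fixed K v) as [i E].
    destruct (acc_smap K i _ _ wv) as [wv' vw'].
    rewrite smap_smap in wv', vw'. rewrite E in wv', vw'.
    apply (proj2_sig b _ _ wv').
    apply (proj2_sig a _ _ vw') in Xv.
    destruct i; [apply H1 | apply H2]; try apply (acc_refl K); exact Xv.
Qed.
Next Obligation.
  apply upset_ext; intro w; simpl. rewrite smap_smap. reflexivity.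
Qed.
Next Obligation.
  apply upset_ext; intro w; simpl; split; [intros [H | H] | tauto]; [| exact H].
  apply (proj2_sig a _ _ (acc_smap1 K w)), H.
Qed.
Next Obligation.
  apply upset_ext; intro w; simpl; split; [tauto | intros _].
  (* By (K5), [s_1(w)] and [s_1(v)] are equivalent whenever [R(w, v)], so if [a] fails at [s_1(w)]
     it fails at [s_1(v)] for every such [v]. *)
  destruct (classic (proj1_sig a (smap K i1 w))) as [H | H];
    [left; exact H | right].
  intros v wv Xv. destruct (acc_smap K i1 _ _ wv) as [_ vw].
  apply H, (proj2_sig a _ _ vw), Xv.
Qed.

(** * Persistence, truth sets as values, and the equivalence *)

Lemma sat_mono (V : Type) (M : HTModel V) (a : formula V) :
  is_upset M (fun w => sat M w a).
Proof.
  induction a as [p | a IHa b IHb | a IHa b IHb | a IHa b IHb | a IHa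
    | i a IHa]; intros w v wv; simpl.
  - apply val_mono, wv.
  - intros [Ha Hb]; split; [apply IHa with w | apply IHb with w]; assumption.
  - intros [H | H]; [left; apply IHa with w | right; apply IHb with w];
      assumption.
  - intros H u vu. apply H, (acc_trans M) with v; assumption.
  - intros H u vu. apply H, (acc_trans M) with v; assumption.
  - apply IHa, (acc_smap M i _ _ wv).
Qed.

Program Definition up_model (V : Type) (M : HTModel V) : AlgModel V := {|
  alg := up_algebra M;
  hom := fun a => exist _ (fun w => sat M w a) (sat_mono M a)
|}.
Solve Obligations with
  intros; apply upset_ext; intro; simpl; reflexivity.

Lemma alg_true_up_model (V : Type) (M : HTModel V) (a : formula V) :
  alg_true (up_model M) a <-> rel_true M a.
Proof.
  unfold alg_true, rel_true.
  rewrite (upset_extE (hom (up_model M) a) (up_top M)); simpl.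
  split; intros H w; [apply H; exact I | split; [intros _; exact I |]].
  intros _; apply H.
Qed.

Lemma alg_rel (V : Type) (Gamma : Ensemble (formula V)) (alpha : formula V) :
  alg_consequence Gamma alpha -> rel_consequence Gamma alpha.
Proof.
  intros H M MG. apply alg_true_up_model, H.
  intros g Gg. apply alg_true_up_model, MG, Gg.
Qed.

Theorem theorem5p5 (VarProp : Type) (VarProp_countable : countable VarProp)
    (Gamma : Ensemble (formula VarProp)) (alpha : formula VarProp) :
  rel_consequence Gamma alpha <-> alg_consequence Gamma alpha.
Proof.
  split; [apply rel_alg | apply alg_rel].
Qed.
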